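(* For every positive integer $m$ and every $0<\varepsilon<1$ there exist constants $\delta=\delta(\varepsilon,m)>0$ and $C=C(\varepsilon,m)>0$ such that the following holds. Let $H=([k],E)$ be an oriented graph with $m$ edges such that $(u,v)\in E$ implies $u<v$, and let $\alpha>0$. Let $\mathcal X_1,\dots,\mathcal X_k$ be finite nonempty sets, and for every edge $(u,v)\in E$ suppose $A_{uv}\subseteq\mathcal X_u\times\mathcal X_v$ has density $\alpha_{uv}\ge\alpha$. If $$\left|\mathbb E\prod_{(u,v)\in E}A_{uv}(\mathbf x_u,\mathbf x_v)-\prod_{(u,v)\in E}\alpha_{uv}\right|\ge\varepsilon\prod_{(u,v)\in E}\alpha_{uv},$$ where $\mathbf x_u\in\mathcal X_u$ ($u\in[k]$) are independent and uniform, then for some $(u,v)\in E$ at least one of the following cases holds: 1. There exist $S\subseteq\mathcal X_u$ and $T\subseteq\mathcal X_v$ of densities $\frac{|S|}{|\mathcal X_u|},\frac{|T|}{|\mathcal X_v|}\ge 2^{-C\log^2(2/\alpha)}$ such that $$\mathbb E_{(\mathbf x,\mathbf y)\in S\times T}[A_{uv}(\mathbf x,\mathbf y)]\ge(1+\delta)\alpha_{uv}.$$ 2. There exists $S\subseteq\mathcal X_u$ of density $\frac{|S|}{|\mathcal X_u|}\ge 2^{-C\log(2/\alpha)}$ such that $$\mathbb E_{\mathbf x\in\mathcal X_v}[A_{uv}(z,\mathbf x)]\le(1-\delta)\alpha_{uv}\qquad\text{for all } z\in S.$$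
   Context: $[k]=\{1,\dots,k\}$. An oriented graph is a directed graph without pairs of opposite directed edges. A set $A_{uv}\subseteq\mathcal X_u\times\mathcal X_v$ is identified with its indicator function, and its density is $|A_{uv}|/(|\mathcal X_u||\mathcal X_v|)$. All expectations are with respect to uniform distributions. $\log$ is base 2 and $\log^2(t)=(\log t)^2$. *)

(* Defs.v *)
From mathcomp Require Import all_boot all_order all_algebra.
From mathcomp Require Import reals exp.

Set Implicit Arguments.
Unset Strict Implicit.
Unset Printing Implicit Defensive.

Import Order.TTheory GRing.Theory Num.Theory.
Local Open Scope ring_scope.

Definition log2 (R : realType) (t : R) : R := ln t / ln 2.

(* A directed graph on the vertex set [k] is given by its edge set, a set of
   ordered pairs; taking u = v shows that [oriented] also excludes loops. *)
Definition oriented (k : nat) (E : {set 'I_k * 'I_k}) : Prop :=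
  forall u v : 'I_k, (u, v) \in E -> (v, u) \notin E.

Definition density (R : realType) (T : finType) (A : {set T}) : R :=
  #|A|%:R / #|T|%:R.

(* Junk value: the expectation over the empty set is 0. *)
Definition expect (R : realType) (T : finType) (D : {set T}) (f : T -> R) : R :=
  (\sum_(x in D) f x) / #|D|%:R.

Definition indic (R : realType) (T : finType) (A : {set T}) (x : T) : R :=
  (x \in A)%:R.

Arguments density R {T} A.
Arguments indic R {T} A x.

(* The x_u are independent and uniform when x is uniform on the product of
   the X_u, that is, on the dependent finite functions. *)
Definition hom_density (R : realType) (k : nat) (E : {set 'I_k * 'I_k})
    (X : 'I_k -> finType) (A : forall u v : 'I_k, {set X u * X v}) : R :=
  expect [set: {dffun forall u : 'I_k, X u}]
    (fun x => \prod_(e in E) indic R (A e.1 e.2) (x e.1, x e.2)).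

Arguments hom_density R {k} E {X} A.

(* Main.v *)
(* Order the edges by head and telescope: it suffices that removing one edge
   (u, v) whose head v is maximal changes the count by a factor 1/alpha_uv up
   to a small relative error. Let f be A_uv - alpha_uv, put to 0 on the set B
   of vertices x_u of low degree; B is tiny unless case 2 holds. As x_v occurs
   only in edges with head v, the error is E F(x) E_y K(x, y) f(x_u, y), where F
   is the product of the edges with other heads and K(x, y) that of the other
   edges with head v. Hoelder's inequality with exponent q ~ log(2/alpha) drops
   F at the cost of a constant factor, and Cauchy-Schwarz over q-tuples of y
   separates K from f. The K part is a count of complete bipartite graphs,
   bounded above as long as no rectangle has increased density (case 1). The f
   part is E_(x,x') <f_x, f_x'>^q; were it large, then
   <A_x, A_x'> >= (1 - 2 delta) alpha_uv^2 + <f_x, f_x'> outside B together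
   with the nonnegativity of all moments of <f_x, f_x'> would make the n-th
   moment of <A_x, A_x'> too large for some n = O(q), again giving a rectangle
   of increased density. *)
Require Import Defs.
From mathcomp Require Import all_boot all_order all_algebra.
From mathcomp Require Import boolp reals exp.
From mathcomp Require Import ring lra.

Set Implicit Arguments.
Unset Strict Implicit.
Unset Printing Implicit Defensive.

Import Order.TTheory GRing.Theory Num.Theory.
Local Open Scope ring_scope.

(** * Cauchy-Schwarz for positive linear functionals *)

Section PositiveFunctional.
Variables (R : realType) (T : Type) (L : (T -> R) -> R).
Hypothesis LD : forall F G, L (fun t => F t + G t) = L F + L G.
Hypothesis LZ : forall a F, L (fun t => a * F t) = a * L F.
Hypothesis L_ge0 : forall F, (forall t, 0 <= F t) -> 0 <= L F.

(** The quadratic form [L ((s F + t G)^2)] in [(s, t)] is nonnegative. Keeping [L] abstract covers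
    weighted averages as well as averages over tuples. *)
Lemma cauchy_schwarz F G :
  L (fun t => F t * G t) ^+ 2 <= L (fun t => F t ^+ 2) * L (fun t => G t ^+ 2).
Proof.
set a := L (fun t => F t ^+ 2); set b := L (fun t => F t * G t).
set c := L (fun t => G t ^+ 2).
have quad s t : 0 <= s ^+ 2 * a + (2 * s * t) * b + t ^+ 2 * c.
  rewrite -!LZ -!LD; apply: L_ge0 => x.
  have -> : s ^+ 2 * F x ^+ 2 + 2 * s * t * (F x * G x) + t ^+ 2 * G x ^+ 2
    = (s * F x + t * G x) ^+ 2 by ring.
  exact: sqr_ge0.
have a_ge0 : 0 <= a by apply: L_ge0 => x; exact: sqr_ge0.
case: (ltrgtP a 0) => [|a_gt0|a0]; first by rewrite ltNge a_ge0.
  (* At [(-b, a)] the form equals [a * (a * c - b^2)]. *)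
  have := quad (- b) a; nra.
have [->|b0] := eqVneq b 0; first by rewrite a0 expr0n mul0r.
(* With [a = 0] and [b] nonzero, the form at this point would be [-1]. *)
have := quad (- (c + 1) / (2 * b)) 1.
have -> : 2 * (- (c + 1) / (2 * b)) * 1 = - (c + 1) / b by field.
rewrite a0 mulr0 add0r mulfVK // expr1n; lra.
Qed.

End PositiveFunctional.

(** * Averages over finite types and over tuples, Hoelder's inequality *)

Section Average.
Variable R : realType.

Definition avg (T : finType) (f : T -> R) : R := (\sum_x f x) / #|T|%:R.

Section Basics.
Variable T : finType.
Implicit Types f g : T -> R.

Lemma eq_avg f g : f =1 g -> avg f = avg g.
Proof. by move=> fg; rewrite /avg (eq_bigr g). Qed.

Lemma avgD f g : avg (fun x => f x + g x) = avg f + avg g.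
Proof. by rewrite /avg big_split mulrDl. Qed.

Lemma avgZ a f : avg (fun x => a * f x) = a * avg f.
Proof. by rewrite /avg -mulr_sumr mulrA. Qed.

Lemma avgZr a f : avg (fun x => f x * a) = avg f * a.
Proof. by rewrite /avg -mulr_suml mulrAC. Qed.

Lemma avgB f g : avg (fun x => f x - g x) = avg f - avg g.
Proof. by rewrite /avg sumrB mulrBl. Qed.

Lemma avg_sum n (F : 'I_n -> T -> R) :
  avg (fun x => \sum_(i < n) F i x) = \sum_(i < n) avg (F i).
Proof. by rewrite /avg exchange_big mulr_suml. Qed.

Lemma le_avg f g : (forall x, f x <= g x) -> avg f <= avg g.
Proof. by move=> fg; rewrite ler_wpM2r ?invr_ge0// ler_sum. Qed.

Lemma avg_ge0 f : (forall x, 0 <= f x) -> 0 <= avg f.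
Proof. by move=> f0; rewrite divr_ge0// sumr_ge0. Qed.

Lemma avg_norm f : `|avg f| <= avg (fun x => `|f x|).
Proof.
rewrite /avg normrM [`|_^-1|]ger0_norm ?invr_ge0//.
by rewrite ler_wpM2r ?invr_ge0// ler_norm_sum.
Qed.

Lemma avg_cst a : (0 < #|T|)%N -> avg (fun _ : T => a) = a.
Proof.
move=> T0; rewrite /avg sumr_const -[a *+ _]mulr_natr mulfK//.
by rewrite pnatr_eq0 -lt0n.
Qed.

Lemma avg_le1 f : (0 < #|T|)%N -> (forall x, f x <= 1) -> avg f <= 1.
Proof. by move=> T0 f1; rewrite -(avg_cst 1 T0) le_avg. Qed.

Lemma avg_indic (S : {set T}) : avg (fun x => (x \in S)%:R) = density R S.
Proof. by rewrite /avg /density -natr_sum -big_mkcond/= sum1_card. Qed.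

Lemma density_le1 (S : {set T}) : density R S <= 1.
Proof.
have [T0|T0] := posnP #|T|; first by rewrite /density T0 invr0 mulr0.
by rewrite ler_pdivrMr ?ltr0n// mul1r ler_nat max_card.
Qed.

End Basics.

Lemma avg_swap (T U : finType) (f : T -> U -> R) :
  avg (fun x => avg (f x)) = avg (fun y => avg (fun x => f x y)).
Proof.
by rewrite /avg -!mulr_suml exchange_big mulrAC.
Qed.

Lemma avg_pair (T U : finType) (f : T * U -> R) :
  avg f = avg (fun x => avg (fun y => f (x, y))).
Proof.
rewrite /avg -mulr_suml pair_bigA/= -mulrA -invfM card_prod -natrM [(#|U| * _)%N]mulnC.
by congr (_ / _); apply: eq_bigr => -[].
Qed.

Lemma cauchy_schwarz_avg (T : finType) (w f : T -> R) : (forall x, 0 <= w x) ->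
  avg (fun x => w x * f x) ^+ 2 <= avg w * avg (fun x => w x * f x ^+ 2).
Proof.
move=> w0.
have := @cauchy_schwarz R T (fun F => avg (fun x => w x * F x)) _ _ _ (fun=> 1) f.
under [X in X ^+ 2 <= _]eq_avg do rewrite mul1r.
under [X in _ <= X * _]eq_avg do rewrite expr1n mulr1.
apply=> [F G|a F|F F0].
- by rewrite -avgD; apply: eq_avg => x; rewrite mulrDr.
- by rewrite -avgZ; apply: eq_avg => x; rewrite mulrCA.
- by apply: avg_ge0 => x; rewrite mulr_ge0.
Qed.

(** Iterating Cauchy-Schwarz with weight [w] doubles the exponent each time; this is why the
    exponent [q] will be a power of two. *)
Lemma hoelder_avg (T : finType) (w f : T -> R) (s : nat) : (forall x, 0 <= w x) ->
  avg (fun x => w x * f x) ^+ (2 ^ s)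
    <= avg w ^+ (2 ^ s).-1 * avg (fun x => w x * f x ^+ (2 ^ s)).
Proof.
move=> w0; elim: s f => [|s IH] f.
  by rewrite expn0 expr0 mul1r.
rewrite expnS exprM.
apply: le_trans (_ : (avg w * avg (fun x => w x * f x ^+ 2)) ^+ (2 ^ s) <= _).
  by rewrite lerXn2r ?nnegrE ?sqr_ge0 ?cauchy_schwarz_avg// mulr_ge0 ?avg_ge0//
    => x; rewrite mulr_ge0 ?sqr_ge0.
have -> : (2 * 2 ^ s).-1 = (2 ^ s + (2 ^ s).-1)%N.
  by case: (2 ^ s)%N (expn_gt0 2 s) => // n _; rewrite mul2n -addnn addnS addSn.
rewrite exprMn exprD -mulrA ler_wpM2l ?exprn_ge0 ?avg_ge0//.
apply: le_trans (IH _) _.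
by under [X in _ * X <= _]eq_avg do rewrite -exprM.
Qed.

(** Expectation over [n] independent uniform points of [Y], collected in a list; the recursion lets
    inductions condition on the first point. *)
Fixpoint iavg (Y : finType) (n : nat) (H : seq Y -> R) : R :=
  if n is n'.+1 then avg (fun y => iavg n' (fun s => H (y :: s))) else H [::].

Section IteratedAverage.
Variable Y : finType.
Implicit Types H G : seq Y -> R.

Lemma eq_iavg n H G : H =1 G -> iavg n H = iavg n G.
Proof.
elim: n H G => [|n IH] H G HG /=; first exact: HG.
by apply: eq_avg => y; apply: IH => s.
Qed.

Lemma iavgD n H G : iavg n (fun s => H s + G s) = iavg n H + iavg n G.
Proof.
elim: n H G => [//|n IH] H G /=; rewrite -avgD; apply: eq_avg => y; exact: IH.
Qed.

Lemma iavgZ n a H : iavg n (fun s => a * H s) = a * iavg n H.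
Proof.
elim: n H => [//|n IH] H /=; rewrite -avgZ; apply: eq_avg => y; exact: IH.
Qed.

Lemma le_iavg n H G : (forall s, H s <= G s) -> iavg n H <= iavg n G.
Proof.
elim: n H G => [|n IH] H G HG /=; first exact: HG.
by apply: le_avg => y; apply: IH => s.
Qed.

Lemma iavg_ge0 n H : (forall s, 0 <= H s) -> 0 <= iavg n H.
Proof.
elim: n H => [|n IH] H H0 /=; first exact: H0.
by apply: avg_ge0 => y; apply: IH => s.
Qed.

Lemma iavg_cst n a : (0 < #|Y|)%N -> iavg n (fun _ : seq Y => a) = a.
Proof. by move=> Y0; elim: n => [//|n IH] /=; rewrite IH avg_cst. Qed.

Lemma iavg_le1 n H : (0 < #|Y|)%N -> (forall s, H s <= 1) -> iavg n H <= 1.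
Proof. by move=> Y0 H1; rewrite -(iavg_cst n 1 Y0) le_iavg. Qed.

Lemma iavg_avg (T : finType) n (F : T -> seq Y -> R) :
  iavg n (fun s => avg (fun x => F x s)) = avg (fun x => iavg n (F x)).
Proof.
elim: n F => [//|n IH] F /=; rewrite avg_swap; apply: eq_avg => y; exact: IH.
Qed.

Lemma iavg_prod n (f : Y -> R) : iavg n (fun s => \prod_(y <- s) f y) = avg f ^+ n.
Proof.
elim: n => [|n IH] /=; first by rewrite big_nil.
rewrite exprS -avgZr; apply: eq_avg => y; rewrite -IH -iavgZ.
by apply: eq_iavg => s; rewrite big_cons.
Qed.

Lemma cauchy_schwarz_iavg n H G :
  iavg n (fun s => H s * G s) ^+ 2
    <= iavg n (fun s => H s ^+ 2) * iavg n (fun s => G s ^+ 2).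
Proof.
apply: cauchy_schwarz => [F1 F2|a F|F F0].
- exact: iavgD.
- exact: iavgZ.
- exact: iavg_ge0.
Qed.

(** Expand the square into a pair [x, x']; for a fixed pair the product over an independent tuple
    averages to a power. In particular every moment of the Gram kernel of [f] is nonnegative. *)
Lemma iavg_sqr (X : finType) n (f : X -> Y -> R) :
  iavg n (fun s => avg (fun x => \prod_(y <- s) f x y) ^+ 2)
  = avg (fun x => avg (fun x' => avg (fun y => f x y * f x' y) ^+ n)).
Proof.
under [in RHS]eq_avg => x do under eq_avg => x' do rewrite -iavg_prod.
under [in RHS]eq_avg => x do rewrite -iavg_avg.
rewrite -iavg_avg; apply: eq_iavg => s.
rewrite expr2 -avgZr; apply: eq_avg => x; rewrite -avgZ; apply: eq_avg => x'.
by rewrite big_split.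
Qed.

End IteratedAverage.
End Average.

Lemma expectE (R : realType) (T : finType) (D : {set T}) (f : T -> R) :
  (0 < #|T|)%N -> expect D f = avg (fun x => (x \in D)%:R * f x) / density R D.
Proof.
move=> T0; rewrite /expect /avg /density invfM invrK.
rewrite -mulrA [_^-1 * (_ * _)]mulrCA mulVf ?mulr1 ?pnatr_eq0 -?lt0n//.
by congr (_ / _); rewrite big_mkcond; apply: eq_bigr => x _; case: ifP => _;
  rewrite (mul1r, mul0r).
Qed.

(** After multiplication by [q!], compare factor by factor: [K (q - i) <= K q - i]. *)
Lemma expn_le_bin (K q : nat) : (K ^ q <= 'C(K * q, q))%N.
Proof.
rewrite -(leq_pmul2r (fact_gt0 q)) bin_ffact -ffactnn !ffact_prod.
rewrite -[in X in (X * _)%N](card_ord q) -prod_nat_const -big_split /=.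
apply: leq_prod => i _; rewrite mulnBr.
by case: K => [|K]; rewrite ?mul0n// leq_sub2l// leq_pmull.
Qed.

(** * Upper bounds for bipartite counts in the absence of dense rectangles *)

Section Counting.
Variable R : realType.

(** Weights instead of sets, because the counting induction produces [[0, 1]]-valued functions; the
    additive [t] pays for rectangles too small to be controlled. *)
Definition rect_bound (X Y : finType) (a : X -> Y -> R) (b t : R) : Prop :=
  forall (g : X -> R) (h : Y -> R),
    (forall x, 0 <= g x <= 1) -> (forall y, 0 <= h y <= 1) ->
  avg (fun x => avg (fun y => g x * h y * a x y)) <= b * (avg g * avg h) + t.

Lemma le_mul_indic (u c : R) : 0 <= u <= 1 -> u * c <= (0 < c)%R%:R * c.
Proof.
by move=> u01; case: ltrP => c0; rewrite ?mul1r ?mul0r; nra.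
Qed.

(* The form is bilinear in (g, h), so it is maximised at indicators; a value
   above t forces both densities above t. *)
Lemma rect_bound_of_no_increment (X Y : finType) (A : {set X * Y}) (b t : R) :
  (0 < #|X|)%N -> (0 < #|Y|)%N -> 0 <= b -> 0 < t ->
  (forall (S : {set X}) (T : {set Y}), t <= density R S -> t <= density R T ->
     expect (setX S T) (indic R A) < b) ->
  rect_bound (fun x y => indic R A (x, y)) b t.
Proof.
move=> X0 Y0 b0 t0 noinc g h g01 h01.
pose a x y := indic R A (x, y).
(* [c x] is the coefficient of [g x] in the form, and [S] keeps the positive ones; [d] and [T] do
   the same for [h] once [g] is replaced by [S]. *)
pose c x := avg (fun y => h y * (a x y - b)).
pose S := [set x | 0 < c x].
pose d y := avg (fun x => (x \in S)%:R * (a x y - b)).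
pose T := [set y | 0 < d y].
have gc : avg (fun x => avg (fun y => g x * h y * a x y)) - b * (avg g * avg h)
    = avg (fun x => g x * c x).
  rewrite -avgZr -avgZ -avgB; apply: eq_avg => x.
  rewrite -!avgZ -avgB; apply: eq_avg => y; ring.
have cd : avg (fun x => (x \in S)%:R * c x) = avg (fun y => h y * d y).
  under eq_avg do rewrite -avgZ; rewrite avg_swap; apply: eq_avg => y.
  by rewrite -avgZ; apply: eq_avg => x; rewrite mulrCA.
pose Q := avg (fun y => (y \in T)%:R * d y).
have leQ : avg (fun x => avg (fun y => g x * h y * a x y)) - b * (avg g * avg h) <= Q.
  rewrite gc; apply: (@le_trans _ _ (avg (fun x => (x \in S)%:R * c x))).
    by apply: le_avg => x; rewrite inE le_mul_indic.
  by rewrite cd; apply: le_avg => y; rewrite inE le_mul_indic.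
rewrite leNgt; apply/negP => big.
have Qt : t < Q by lra.
have XY0 : (0 < #|{: X * Y}|)%N by rewrite card_prod muln_gt0 X0.
pose I := avg (fun p => (p \in setX S T)%:R * indic R A p).
have QE : Q = I - b * (density R S * density R T).
  have -> : Q = avg (fun x => avg (fun y =>
      (y \in T)%:R * ((x \in S)%:R * (a x y - b)))).
    by rewrite avg_swap; apply: eq_avg => y; rewrite -avgZ.
  rewrite /I avg_pair -!avg_indic -avgZr -avgZ -avgB; apply: eq_avg => x.
  rewrite -!avgZ -avgB; apply: eq_avg => y; rewrite in_setX -mulnb natrM /a; ring.
have dXY : density R (setX S T) = density R S * density R T.
  by rewrite /density cardsX card_prod !natrM; field; rewrite !pnatr_eq0 -!lt0n X0 Y0.
have ST0 (U : finType) (V : {set U}) : 0 <= density R V by rewrite /density divr_ge0.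
have Ile : I <= density R S * density R T.
  rewrite -dXY -avg_indic; apply: le_avg => p; rewrite /indic.
  by case: (_ \in A); case: (_ \in setX _ _); rewrite /= ?mulr0 ?mul0r ?mulr1.
have QST : Q <= density R S * density R T.
  have := mulr_ge0 b0 (mulr_ge0 (ST0 _ S) (ST0 _ T)); rewrite QE; lra.
have tS : t < density R S.
  by have := density_le1 R T; have := ST0 _ S; have := ST0 _ T; nra.
have tT : t < density R T.
  by have := density_le1 R S; have := ST0 _ S; have := ST0 _ T; nra.
(* No increment on [S] and [T] means [Q < 0], against [t < Q]. *)
have := noinc S T (ltW tS) (ltW tT); rewrite expectE// dXY ltr_pdivrMr; last by nra.
by rewrite -/I; move: QE Qt; lra.
Qed.

(** Fix the first point [y] of the tuple: [a x y] is absorbed into the weight [g], and the mean of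
    [H] over the remaining points becomes the weight [h y]. Averaging over [y], the rectangle bound
    yields one factor [b] and a new error [b ^+ n * t], at most [2 ^+ n * t]. *)
Lemma upper_count (X Y : finType) (a : X -> Y -> R) (b t : R) (n : nat)
    (g : X -> R) (H : seq Y -> R) :
  (0 < #|X|)%N -> (0 < #|Y|)%N -> 0 <= b <= 2 -> 0 <= t -> rect_bound a b t ->
  (forall x y, 0 <= a x y <= 1) -> (forall x, 0 <= g x <= 1) ->
  (forall s, 0 <= H s <= 1) ->
  iavg n (fun s => H s * avg (fun x => g x * \prod_(y <- s) a x y))
    <= b ^+ n * (avg g * iavg n H) + n%:R * 2 ^+ n * t.
Proof.
move=> X0 Y0 b02 t0 rb a01; elim: n g H => [|n IH] g H g01 H01 /=.
  rewrite !mul0r addr0 mul1r mulrC ler_wpM2r//; first by case/andP: (H01 [::]).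
  by apply: le_avg => x; rewrite big_nil mulr1.
pose h y := iavg n (fun s => H (y :: s)).
have h01 y : 0 <= h y <= 1.
  by rewrite iavg_ge0 ?iavg_le1// => s; case/andP: (H01 (y :: s)).
apply: le_trans (_ : avg (fun y => b ^+ n * (avg (fun x => g x * a x y) * h y)
    + n%:R * 2 ^+ n * t) <= _).
  apply: le_avg => y; apply: le_trans (IH _ _ _ _); last 2 first.
  - by move=> x; have := g01 x; have := a01 x y; nra.
  - by move=> s; exact: H01.
  apply: le_iavg => s; rewrite ler_wpM2l//; first by case/andP: (H01 (y :: s)).
  by apply: le_avg => x; rewrite big_cons mulrA.
rewrite avgD avg_cst// avgZ.
have -> : avg (fun y => avg (fun x => g x * a x y) * h y)
    = avg (fun x => avg (fun y => g x * h y * a x y)).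
  rewrite avg_swap; apply: eq_avg => y; rewrite -avgZr; apply: eq_avg => x.
  by rewrite mulrAC.
have bn0 : 0 <= b ^+ n by rewrite exprn_ge0//; case/andP: b02.
have bn2 : b ^+ n <= 2 ^+ n by rewrite lerXn2r// ?nnegrE; case/andP: b02.
have := ler_wpM2l bn0 (rb g h g01 h01); rewrite -/h.
have n0 : 0 <= n%:R :> R by [].
have t2 : b ^+ n * t <= 2 ^+ n * t by rewrite ler_wpM2r.
have tn : 0 <= n%:R * 2 ^+ n * t by rewrite !mulr_ge0// exprn_ge0.
have tp : 0 <= 2 ^+ n * t by rewrite mulr_ge0// exprn_ge0.
rewrite -[n.+1]addn1 natrD !exprD !expr1; move: t2 tn tp.
set p := 2 ^+ n; set B := b ^+ n; set I := avg _; move=> t2 tn tp le1; nra.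
Qed.

Lemma prod_unit (I : Type) (r : seq I) (f : I -> R) :
  (forall i, 0 <= f i <= 1) -> 0 <= \prod_(i <- r) f i <= 1.
Proof.
move=> f01; rewrite prodr_ge0 /=; last by move=> i _; case/andP: (f01 i).
by rewrite prodr_ile1// => i _; exact: f01.
Qed.

Lemma avg_unit (T : finType) (f : T -> R) : (0 < #|T|)%N ->
  (forall x, 0 <= f x <= 1) -> 0 <= avg f <= 1.
Proof.
by move=> T0 f01; rewrite avg_ge0 ?avg_le1// => x; case/andP: (f01 x).
Qed.

(** Peel off one index at a time. Its squared average is two factors, each removed by [upper_count]
    with all the rest as the weight [H]; the factor 4 per index absorbs the additive errors. *)
Lemma upper_count_prod (I : eqType) (r : seq I) (X : I -> finType) (Y : finType)
    (a : forall i, X i -> Y -> R) (b : I -> R) (t p : R) (n : nat) :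
  (forall i, 0 < #|X i|)%N -> (0 < #|Y|)%N -> 0 <= t -> 0 < p <= 1 ->
  (forall i x y, 0 <= a i x y <= 1) ->
  (forall i, i \in r -> p <= b i <= 2) ->
  (forall i, i \in r -> rect_bound (a i) (b i) t) ->
  n%:R * 2 ^+ n * t <= p ^+ (2 * n * size r) ->
  iavg n (fun s => \prod_(i <- r) avg (fun x => \prod_(y <- s) a i x y) ^+ 2)
    <= \prod_(i <- r) (4 * b i ^+ (2 * n)).
Proof.
move=> X0 Y0 t0 p01 a01; have [p0 p1] := andP p01.
elim: r => [|i r IH] br rb small.
  by under eq_iavg do rewrite big_nil; rewrite iavg_cst// big_nil.
have {}IH : iavg n (fun s => \prod_(i <- r) avg (fun x => \prod_(y <- s) a i x y) ^+ 2)
    <= \prod_(i <- r) (4 * b i ^+ (2 * n)).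
  apply: IH => [j jr|j jr|]; [apply: br|apply: rb|]; rewrite ?inE ?jr ?orbT//.
  apply: le_trans small _; apply: ler_wiXn2l; rewrite ?(ltW p0)//.
  by rewrite leq_mul2l leqnSn orbT.
(* A lower bound on the main term, against which the additive errors are measured. *)
have B_ge : p ^+ (2 * n * size r) <= \prod_(i <- r) (4 * b i ^+ (2 * n)).
  elim: r br {rb small IH} => [|j r IH] br; first by rewrite muln0 big_nil.
  rewrite big_cons /= mulnS exprD.
  have /andP[pj _] : p <= b j <= 2 by apply: br; rewrite !inE eqxx orbT.
  have bj : p ^+ (2 * n) <= b j ^+ (2 * n).
    by rewrite lerXn2r ?nnegrE ?(ltW p0)// (le_trans _ pj)// ltW.
  apply: ler_pM; rewrite ?exprn_ge0 ?(ltW p0)//.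
    by have := exprn_ge0 (2 * n) (ltW p0); lra.
  apply: IH => l; rewrite inE => /orP[li|lr]; apply: br.
    by rewrite inE li.
  by rewrite !inE lr !orbT.
set B := \prod_(i <- r) _ in IH B_ge *.
have bi : p <= b i <= 2 by apply: br; rewrite inE eqxx.
have rbi : rect_bound (a i) (b i) t by apply: rb; rewrite inE eqxx.
pose h s := avg (fun x => \prod_(y <- s) a i x y).
have h01 s : 0 <= h s <= 1 by apply: avg_unit => // x; exact: prod_unit.
pose G s := \prod_(i <- r) avg (fun x => \prod_(y <- s) a i x y) ^+ 2.
have G01 s : 0 <= G s <= 1.
  apply: prod_unit => j; rewrite sqr_ge0 expr_le1//.
    by have /andP[] : 0 <= avg (fun x => \prod_(y <- s) a j x y) <= 1
      by apply: avg_unit => // x; exact: prod_unit.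
  by apply: avg_ge0 => x; case/andP: (prod_unit s (a01 j x)).
have step H : (forall s, 0 <= H s <= 1) ->
    iavg n (fun s => H s * h s) <= b i ^+ n * iavg n H + n%:R * 2 ^+ n * t.
  move=> H01.
  have := @upper_count _ _ (a i) (b i) t n (fun=> 1) H (X0 i) Y0 _ t0 rbi (a01 i) _ H01.
  rewrite avg_cst// mul1r; under eq_iavg => s do under eq_avg do rewrite mul1r.
  by apply=> [|_]; rewrite ?ler01 ?lexx//; lra.
set e := n%:R * 2 ^+ n * t in small step.
have pn0 : 0 < p ^+ n by rewrite exprn_gt0.
have pn1 : p ^+ n <= 1 by rewrite exprn_ile1 ?(ltW p0).
have bn : p ^+ n <= b i ^+ n by rewrite lerXn2r ?nnegrE//; lra.
have B0 : 0 < B by apply: lt_le_trans B_ge; rewrite exprn_gt0.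
have p2n : p ^+ (2 * n) = p ^+ n * p ^+ n by rewrite mul2n -addnn exprD.
have eB : e <= b i ^+ n * b i ^+ n * B.
  apply: le_trans small _; rewrite /= mulnS exprD p2n.
  apply: ler_pM => //; first by rewrite !mulr_ge0 ?ltW.
    by rewrite exprn_ge0 ?ltW.
  by apply: ler_pM => //; exact: ltW.
have eB' : e <= b i ^+ n * B.
  apply: le_trans small _; rewrite /= mulnS exprD p2n.
  apply: ler_pM => //; first by rewrite !mulr_ge0 ?ltW.
    by rewrite exprn_ge0 ?ltW.
  by apply: le_trans bn; rewrite ger_pMr.
have S1 := step G G01.
have S2 : iavg n (fun s => G s * h s * h s)
    <= b i ^+ n * iavg n (fun s => G s * h s) + e.
  by apply: step => s; have := G01 s; have := h01 s; nra.
rewrite big_cons -/B; under eq_iavg => s do rewrite big_cons mulrC expr2 mulrA.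
apply: le_trans S2 _; rewrite mul2n -addnn exprD.
have bn0 : 0 < b i ^+ n by exact: lt_le_trans bn.
have S1' := ler_wpM2l (ltW bn0) S1.
have S0' := ler_wpM2l (ltW (mulr_gt0 bn0 bn0)) IH.
have eB'' := ler_wpM2l (ltW bn0) eB'.
(* One copy is the main term; the other two absorb the errors [b i ^+ n * e] and [e]. *)
apply: (@le_trans _ _ (3 * (b i ^+ n * b i ^+ n * B))).
  by move: S1' S0' eB'' eB; rewrite !mulrDr !mulrA; lra.
by have := mulr_ge0 (mulr_ge0 (ltW bn0) (ltW bn0)) (ltW B0); rewrite !mulrA; lra.
Qed.
End Counting.

(** * From many rectangles counted correctly to a small grid norm *)

Section GridNorm.
Variable R : realType.

(** In the binomial expansion every term is nonnegative, as all moments of the Gram kernel are; the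
    left side is the term of index [q]. *)
Lemma gram_expansion (X Y : finType) (f : X -> Y -> R) (c : R) (n q : nat) :
  0 <= c -> (q <= n)%N ->
  'C(n, q)%:R * c ^+ (n - q) * avg (fun x => avg (fun x' =>
      avg (fun y => f x y * f x' y) ^+ q))
    <= avg (fun x => avg (fun x' => (c + avg (fun y => f x y * f x' y)) ^+ n)).
Proof.
move=> c0 qn; pose g x x' := avg (fun y => f x y * f x' y).
have M0 i : 0 <= avg (fun x => avg (fun x' => g x x' ^+ i)).
  by rewrite -iavg_sqr; apply: iavg_ge0 => s; exact: sqr_ge0.
have -> : avg (fun x => avg (fun x' => (c + g x x') ^+ n))
    = \sum_(i < n.+1) 'C(n, i)%:R * c ^+ (n - i)
        * avg (fun x => avg (fun x' => g x x' ^+ i)).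
  under [RHS]eq_bigr => i _.
    rewrite -avgZ; under eq_avg do rewrite -avgZ; over.
  rewrite -avg_sum; apply: eq_avg => x; rewrite -avg_sum; apply: eq_avg => x'.
  by rewrite exprDn; apply: eq_bigr => i _; rewrite mulr_natl mulrnAl.
have qn1 : (q < n.+1)%N by [].
rewrite (bigD1 (Ordinal qn1))//= lerDl sumr_ge0// => i _.
by apply: mulr_ge0 (M0 i); apply: mulr_ge0; rewrite ?exprn_ge0.
Qed.

(** If the [q]-th moment of the Gram kernel [g] were larger, its term in the [n]-th moment of
    [c + g], with [n = K q + 1], would exceed [16 ^+ q * c ^+ n]. But off [B] the sum [c + g] is at
    most the codegree [t], whose [n]-th moment is at most [4 * 2 ^+ q * c ^+ n] by hypothesis. *)
Lemma grid_norm_le (X Y : finType) (a : X -> Y -> R) (B : {set X})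
    (al eta dl : R) (K q : nat) :
  (0 < #|X|)%N -> (0 < #|Y|)%N -> 0 < al -> 0 <= dl < 1 / 2 ->
  16 <= K%:R * eta ^+ 2 -> (0 < q)%N -> ~~ odd q ->
  (1 + dl) ^+ (2 * K.+1) <= 2 * (1 - 2 * dl) ^+ K.+1 ->
  (forall x y, 0 <= a x y) ->
  (forall x, x \notin B -> (1 - dl) * al <= avg (a x)) ->
  iavg (K * q).+1 (fun s => avg (fun x => \prod_(y <- s) a x y) ^+ 2)
    <= 4 * ((1 + dl) * al) ^+ (2 * (K * q).+1) ->
  iavg q (fun s => avg (fun x => \prod_(y <- s) ((x \notin B)%:R * (a x y - al))) ^+ 2)
    <= (eta * al) ^+ (2 * q).
Proof.
move=> X0 Y0 al0 dl01 Keta q0 qev dlK a0 degB; set n := (K * q).+1 => upper.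
rewrite leNgt; apply/negP => big.
pose f x y := (x \notin B)%:R * (a x y - al).
pose g x x' := avg (fun y => f x y * f x' y).
pose t x x' := avg (fun y => a x y * a x' y).
pose w := 1 - 2 * dl; pose c := w * al ^+ 2.
have w0 : 0 < w by rewrite /w; lra.
have c0 : 0 < c by rewrite mulr_gt0// exprn_gt0.
(* Oddness makes [u ^+ n <= 0] for negative [u], so [c + g <= t] can be raised to the power [n]
   without knowing the sign of [c + g]. *)
have nodd : odd n by rewrite /n /= oddM negb_and qev orbT.
have K0 : (0 < K)%N by case: K Keta {dlK n upper nodd} => //; rewrite mul0r; lra.
have qn : (q <= n)%N by rewrite /n ltnW// ltnS leq_pmull.
(* If [x] or [x'] lies in [B], then [g] vanishes and the term [c ^+ n] suffices; otherwise both
   degrees are at least [(1 - dl) * al]. *)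
have pt x x' : (c + g x x') ^+ n <= t x x' ^+ n + c ^+ n.
  have t0 : 0 <= t x x' by apply: avg_ge0 => y; rewrite mulr_ge0.
  have tn0 : 0 <= t x x' ^+ n by rewrite exprn_ge0.
  have cn0 : 0 <= c ^+ n by rewrite exprn_ge0// ltW.
  have [xB|xB] := boolP (x \in B).
    rewrite (_ : g x x' = 0) ?addr0 ?lerDr//.
    by rewrite /g -[RHS](avg_cst 0 Y0); apply: eq_avg => y; rewrite /f xB !mul0r.
  have [xB'|xB'] := boolP (x' \in B).
    rewrite (_ : g x x' = 0) ?addr0 ?lerDr//.
    by rewrite /g -[RHS](avg_cst 0 Y0); apply: eq_avg => y; rewrite /f xB' mul0r mulr0.
  have gE : g x x' = t x x' - al * (avg (a x) + avg (a x')) + al ^+ 2.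
    rewrite /g /t -avgD -avgZ -avgB -(avg_cst (al ^+ 2) Y0) -avgD.
    by apply: eq_avg => y; rewrite /f xB xB' /=; ring.
  have le_t : c + g x x' <= t x x'.
    by have := degB _ xB; have := degB _ xB'; rewrite gE /c /w; nra.
  apply: (@le_trans _ _ (t x x' ^+ n)); last by rewrite lerDl.
  have [cg|cg] := lerP 0 (c + g x x'); first by rewrite lerXn2r.
  by apply: le_trans tn0; rewrite exprn_odd_le0// ltW.
have := le_trans (gram_expansion f (ltW c0) qn)
  (le_avg (fun x => le_avg (pt x))).
under [X in _ <= X]eq_avg do rewrite avgD avg_cst//.
rewrite avgD avg_cst// -!iavg_sqr; apply/negP; rewrite -ltNge.
apply: le_lt_trans (_ : 4 * ((1 + dl) * al) ^+ (2 * n) + c ^+ n < _).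
  by rewrite lerD2r.
apply: lt_le_trans
  (_ : 'C(n, q)%:R * c ^+ (n - q) * (eta * al) ^+ (2 * q) <= _); last first.
  by rewrite ler_wpM2l ?ltW// mulr_gt0 ?exprn_gt0// ltr0n bin_gt0.
(* The binomial coefficient is at least [K ^ q], and [K * eta^2 >= 16] while [c <= al^2]. *)
have step1 : 16 ^+ q * c ^+ n <= 'C(n, q)%:R * c ^+ (n - q) * (eta * al) ^+ (2 * q).
  apply: (@le_trans _ _ (K%:R ^+ q * c ^+ (n - q) * (eta * al) ^+ (2 * q))); last first.
    rewrite ler_wpM2r//; first by rewrite exprM exprn_ge0// sqr_ge0.
    rewrite ler_wpM2r ?exprn_ge0 ?(ltW c0)// -natrX ler_nat.
    by rewrite (leq_trans (expn_le_bin _ _))// leq_bin2l.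
  rewrite -{1}(subnK qn) exprD mulrCA [leRHS]mulrAC [leRHS]mulrC.
  rewrite ler_wpM2l ?exprn_ge0 ?(ltW c0)// exprM -!exprMn lerXn2r ?nnegrE//.
  - by rewrite mulr_ge0// ltW.
  - by rewrite mulr_ge0 ?sqr_ge0.
  - by rewrite exprMn /c /w; have := sqr_ge0 al; nra.
(* Since [n <= (K + 1) * q], the ratio [((1 + dl)^2 / w) ^+ n] is at most the [q]-th power of what
   [dlK] bounds by 2. *)
have step2 : ((1 + dl) * al) ^+ (2 * n) <= 2 ^+ q * c ^+ n.
  rewrite exprMn [al ^+ (2 * n)]exprM /c [(w * _) ^+ n]exprMn [leRHS]mulrA ler_wpM2r//.
    by rewrite exprn_ge0// sqr_ge0.
  have r1 : 1 <= (1 + dl) ^+ 2 / w.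
    by rewrite ler_pdivlMr// /w; nra.
  rewrite -ler_pdivrMr ?exprn_gt0// exprM -expr_div_n.
  apply: (@le_trans _ _ (((1 + dl) ^+ 2 / w) ^+ (K.+1 * q))).
    by rewrite ler_weXn2l// /n mulSn addnC -addn1 leq_add2l.
  rewrite exprM lerXn2r ?nnegrE ?exprn_ge0//; first by lra.
  by rewrite expr_div_n -exprM ler_pdivrMr ?exprn_gt0.
have p16 : 4 * 2 ^+ q + 1 < 16 ^+ q :> R.
  have -> : 16 = 2 * 8 :> R by ring.
  have h8 : 8 <= 8 ^+ q :> R by rewrite -[leLHS]expr1 ler_weXn2l//; lra.
  have h2 : 1 <= 2 ^+ q :> R by rewrite exprn_ege1//; lra.
  rewrite exprMn; nra.
have cn0 : 0 < c ^+ n by rewrite exprn_gt0.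
apply: lt_le_trans step1.
apply: le_lt_trans (_ : (4 * 2 ^+ q + 1) * c ^+ n < _); last by rewrite ltr_pM2r.
by have := ler_wpM2l (ler0n R 4) step2; lra.
Qed.
End GridNorm.

(** * Independent coordinates and the removal of one edge *)

Section Product.
Variables (R : realType) (k : nat) (X : 'I_k -> finType).
Hypothesis X0 : forall u, (0 < #|X u|)%N.
Notation point := {dffun forall u : 'I_k, X u}.

Lemma card_point_gt0 : (0 < #|{: point}|)%N.
Proof.
have inh u : exists x : X u, true by have /card_gt0P[x _] := X0 u; exists x.
by apply/card_gt0P; exists [ffun u => xchoose (inh u)].
Qed.

Definition update (x : point) (v : 'I_k) (y : X v) : point :=
  [ffun u => eqtype.dfwith (fun w => x w) y u].

Lemma update_in x v y : @update x v y v = y.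
Proof. by rewrite ffunE eqtype.dfwith_in. Qed.

Lemma update_out x v y u : u != v -> @update x v y u = x u.
Proof. by move=> uv; rewrite ffunE eqtype.dfwith_out// eq_sym. Qed.

(** Exchanging coordinate [v] with a fresh point of [X v] is an involution of the product space, so
    it preserves the uniform measure. All independence statements below come from this. *)
Lemma avg_resample v (F : point -> R) :
  avg F = avg (fun x => avg (fun y : X v => F (update x y))).
Proof.
transitivity (avg (fun p : point * X v => F p.1)).
  by rewrite avg_pair; apply: eq_avg => x; rewrite /= avg_cst.
rewrite -(avg_pair (fun p : point * X v => F (update p.1 p.2))) /avg.
pose swap (p : point * X v) := (update p.1 p.2, p.1 v).
have swapK : involutive swap.
  move=> [x y]; rewrite /swap /= update_in; congr (_, _); apply/ffunP => u.
  have [->|uv] := eqVneq u v; first by rewrite update_in.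
  by rewrite !update_out.
by rewrite (reindex_inj (inv_inj swapK)).
Qed.

Lemma avg_marginal u (c : X u -> R) : avg (fun x : point => c (x u)) = avg c.
Proof.
rewrite (avg_resample u); under eq_avg do under eq_avg do rewrite update_in.
by rewrite avg_cst// card_point_gt0.
Qed.

Lemma avg_indep_cons u (r : seq 'I_k) (c : X u -> R) (h : forall i, X i -> R) :
  u \notin r ->
  avg (fun x : point => c (x u) * \prod_(i <- r) h i (x i))
    = avg c * avg (fun x : point => \prod_(i <- r) h i (x i)).
Proof.
move=> ur; rewrite (avg_resample u) -avgZ; apply: eq_avg => x; rewrite -avgZr.
apply: eq_avg => y; rewrite update_in; congr (_ * _); apply: eq_big_seq => i ir.
by rewrite update_out//; apply: contraNneq ur => <-.
Qed.

Lemma avg_indep (r : seq 'I_k) (h : forall i, X i -> R) : uniq r ->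
  avg (fun x : point => \prod_(i <- r) h i (x i)) = \prod_(i <- r) avg (h i).
Proof.
elim: r => [_|u r IH /= /andP[ur ru]].
  by under eq_avg do rewrite big_nil; rewrite big_nil avg_cst// card_point_gt0.
by rewrite big_cons -IH// -avg_indep_cons//; apply: eq_avg => x; rewrite big_cons.
Qed.

Variable a : forall i j : 'I_k, X i -> X j -> R.
Arguments a : clear implicits.
Hypothesis a01 : forall i j x y, 0 <= a i j x y <= 1.

Definition hom_prod (P : {set 'I_k * 'I_k}) (x : point) : R :=
  \prod_(e in P) a e.1 e.2 (x e.1) (x e.2).

Lemma hom_prod_unit P x : 0 <= hom_prod P x <= 1.
Proof.
rewrite /hom_prod prodr_ge0 => [|e _]; last by case/andP: (a01 (x e.1) (x e.2)).
by rewrite prodr_ile1// => e _; exact: a01.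
Qed.

(** A list rather than a set, because products over tails are handled by induction on lists. *)
Definition sources (P : {set 'I_k * 'I_k}) (v : 'I_k) := enum [set i | (i, v) \in P].

Lemma prod_split_head (P : {set 'I_k * 'I_k}) v (G : 'I_k * 'I_k -> R) :
  \prod_(e in P) G e
    = \prod_(e in [set e in P | e.2 != v]) G e * \prod_(i <- sources P v) G (i, v).
Proof.
rewrite (bigID (fun e => e.2 != v))/=; congr (_ * _).
  by apply: eq_bigl => e; rewrite inE.
rewrite big_enum/= (reindex_onto (fun i => (i, v)) fst) /=; last first.
  by case=> i j /= /andP[_]; rewrite negbK => /eqP ->.
by apply: eq_bigl => i; rewrite inE !eqxx !andbT.
Qed.

Section RemoveEdge.
Variables (P : {set 'I_k * 'I_k}) (u v : 'I_k).
Hypothesis uv : u != v.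
Hypothesis uvP : (u, v) \notin P.
Hypothesis vP : forall i j, (i, j) \in P -> i != v.
Variable f : X u -> X v -> R.

Let F := [set e in P | e.2 != v].
Let r := sources P v.

(** The part of the count that involves coordinate [v], averaged over that coordinate; the result no
    longer depends on [x v]. *)
Definition fibre_avg (x : point) : R :=
  avg (fun y => \prod_(i <- r) a i v (x i) y * f (x u) y).

(** No edge of [P] leaves [v], so resampling [x v] affects only [f] and the edges with head [v]. *)
Lemma avg_fibre :
  avg (fun x => hom_prod P x * f (x u) (x v))
    = avg (fun x => hom_prod F x * fibre_avg x).
Proof.
rewrite (avg_resample v); apply: eq_avg => x; rewrite -avgZ; apply: eq_avg => y.
rewrite {1}/hom_prod (prod_split_head P v) mulrA.
congr (_ * _ * _); last by rewrite update_in update_out.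
  apply: eq_bigr => -[i j]; rewrite inE /= => /andP[ijP jv].
  by rewrite !update_out// (vP ijP).
apply: eq_big_seq => i; rewrite mem_enum inE /= => ivP.
by rewrite update_in update_out// (vP ivP).
Qed.

(** A [q]-th power is an average over [q]-tuples of [y]. For a fixed tuple the factors live on
    distinct coordinates, [u] not being in [r] because [(u, v)] is not in [P], so they are
    independent. *)
Lemma avg_fibre_exp q :
  avg (fun x => fibre_avg x ^+ q)
  = iavg q (fun s => avg (fun x => \prod_(y <- s) f x y)
      * \prod_(i <- r) avg (fun x => \prod_(y <- s) a i v x y)).
Proof.
under eq_avg do rewrite -iavg_prod; rewrite -iavg_avg; apply: eq_iavg => s.
rewrite -(avg_indep (fun i x => \prod_(y <- s) a i v x y)) ?enum_uniq//.
rewrite -(avg_indep_cons (fun x => \prod_(y <- s) f x y)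
  (fun i x => \prod_(y <- s) a i v x y)); last by rewrite mem_enum inE.
apply: eq_avg => x; rewrite big_split/= mulrC exchange_big//.
Qed.

(** Hoelder with weight [hom_prod F] reduces to the [q]-th moment of [fibre_avg]; Cauchy-Schwarz
    over tuples then separates [f] from the other edges into [v]. *)
Lemma fibre_bound (s : nat) (c d z : R) : (0 < s)%N -> 0 <= c -> 0 <= d ->
  0 <= z -> avg (hom_prod F) <= 2 * z -> 1 <= 2 ^+ (2 ^ s) * z ->
  iavg (2 ^ s) (fun t => avg (fun x => \prod_(y <- t) f x y) ^+ 2)
    <= c ^+ (2 * 2 ^ s) ->
  iavg (2 ^ s) (fun t => \prod_(i <- r) avg (fun x => \prod_(y <- t) a i v x y) ^+ 2)
    <= d ^+ (2 * 2 ^ s) ->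
  `|avg (fun x => hom_prod P x * f (x u) (x v))| <= 4 * z * c * d.
Proof.
move=> s0 c0 d0 z0 Fz z1 fc rd; set q := (2 ^ s)%N in z1 fc rd *.
have q0 : (0 < q)%N by rewrite expn_gt0.
have qev : ~~ odd q by rewrite /q oddX negb_or -lt0n s0.
have F01 x : 0 <= hom_prod F x <= 1 by exact: hom_prod_unit.
have F0 x : 0 <= hom_prod F x by case/andP: (F01 x).
have F1 x : hom_prod F x <= 1 by case/andP: (F01 x).
rewrite avg_fibre; set Z := avg _.
have M0 : 0 <= avg (fun x => fibre_avg x ^+ q).
  by apply: avg_ge0 => x; rewrite exprn_even_ge0.
have Zq : Z ^+ q <= (2 * z) ^+ q.-1 * avg (fun x => fibre_avg x ^+ q).
  apply: le_trans (hoelder_avg _ _ F0) _.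
  apply: ler_pM.
  - by rewrite exprn_ge0// avg_ge0.
  - by apply: avg_ge0 => x; rewrite mulr_ge0// exprn_even_ge0.
  - by rewrite lerXn2r ?nnegrE ?avg_ge0// mulr_ge0.
  - by apply: le_avg => x; rewrite ler_piMl// exprn_even_ge0.
have M2 : avg (fun x => fibre_avg x ^+ q) ^+ 2 <= c ^+ (2 * q) * d ^+ (2 * q).
  rewrite avg_fibre_exp; apply: le_trans (cauchy_schwarz_iavg _ _ _) _.
  apply: ler_pM => //; try by apply: iavg_ge0 => t; rewrite sqr_ge0.
  by under eq_iavg do rewrite -prodrXl.
(* Hoelder leaves only [q - 1] powers of [2 * z]; the missing one costs a factor 2 inside the [q]-th
   power, as [2 ^+ q * z >= 1]. *)
have z2 : (2 * z) ^+ (2 * q.-1) <= (4 * z) ^+ (2 * q).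
  have -> : (4 * z) ^+ (2 * q) = (2 * z) ^+ (2 * q.-1) * (2 ^+ q * (2 * z)) ^+ 2.
    rewrite -{1}(prednK q0) (_ : 4 * z = 2 * (2 * z)); last by ring.
    rewrite exprMn mulnS exprD [(2 * z) ^+ (2 + _)]exprD exprMn.
    rewrite -[in RHS](prednK q0) exprMn [2 ^+ q.-1.+1]exprSr.
    by rewrite [2 ^+ (2 * q.-1)]exprM exprAC; ring.
  rewrite ler_peMr ?exprn_ge0 ?mulr_ge0// exprn_ege1//.
  by rewrite mulrCA; lra.
have Z2 : `|Z| ^+ (2 * q) <= (4 * z * c * d) ^+ (2 * q).
  have -> : `|Z| ^+ (2 * q) = (Z ^+ q) ^+ 2.
    rewrite -normrX ger0_norm ?[in RHS]mulnC -?exprM 1?mulnC//.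
    by rewrite exprn_even_ge0// oddM negb_and orbT.
  apply: (@le_trans _ _ (((2 * z) ^+ q.-1 * avg (fun x => fibre_avg x ^+ q)) ^+ 2)).
    by rewrite lerXn2r// nnegrE ?exprn_even_ge0// mulr_ge0// exprn_ge0// mulr_ge0.
  have -> : (4 * z * c * d) ^+ (2 * q)
      = (4 * z) ^+ (2 * q) * (c ^+ (2 * q) * d ^+ (2 * q)).
    by rewrite -!exprMn !mulrA.
  rewrite [leLHS]exprMn -[X in X * _]exprM [(q.-1 * 2)%N]mulnC.
  by apply: ler_pM; rewrite ?sqr_ge0 ?exprn_ge0 ?mulr_ge0.
rewrite -(@ler_pXn2r _ (2 * q)) ?muln_gt0// nnegrE ?normr_ge0//.
by rewrite !mulr_ge0.
Qed.
End RemoveEdge.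

(** Split [a u v - al u v] into its part off [B], bounded through [fibre_bound] with constant
    [4 * 4], and its part on [B], bounded by the density of [B]; hence [16 + 1]. *)
Lemma remove_edge (P : {set 'I_k * 'I_k}) (u v : 'I_k) (B : {set X u})
    (al : 'I_k -> 'I_k -> R) (s : nat) (eta : R) :
  u != v -> (u, v) \notin P -> (forall i j, (i, j) \in P -> i != v) ->
  (forall i j, 0 < al i j <= 1) -> (0 < s)%N -> 0 <= eta ->
  density R B <= eta * (al u v * \prod_(e in P) al e.1 e.2) ->
  1 <= 2 ^+ (2 ^ s) * \prod_(e in P) al e.1 e.2 ->
  avg (hom_prod [set e in P | e.2 != v])
    <= 2 * \prod_(e in [set e in P | e.2 != v]) al e.1 e.2 ->
  iavg (2 ^ s) (fun t => avg (fun x =>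
      \prod_(y <- t) ((x \notin B)%:R * (a u v x y - al u v))) ^+ 2)
    <= (eta * al u v) ^+ (2 * 2 ^ s) ->
  iavg (2 ^ s) (fun t => \prod_(i <- sources P v)
      avg (fun x => \prod_(y <- t) a i v x y) ^+ 2)
    <= (4 * \prod_(i <- sources P v) al i v) ^+ (2 * 2 ^ s) ->
  `|avg (hom_prod ((u, v) |: P)) - al u v * avg (hom_prod P)|
    <= 17 * eta * \prod_(e in (u, v) |: P) al e.1 e.2.
Proof.
move=> uv uvP vP al01 s0 eta0 Bsmall Pbig Fle fle rle.
have al0 i j : 0 <= al i j by rewrite ltW//; case/andP: (al01 i j).
have al1 i j : 0 <= al i j <= 1 by rewrite al0; case/andP: (al01 i j).
pose f (x : X u) y := (x \notin B)%:R * (a u v x y - al u v).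
pose F := [set e in P | e.2 != v].
set z := \prod_(e in F) al e.1 e.2 in Fle *.
set d := \prod_(i <- sources P v) al i v in rle *.
have Psplit : \prod_(e in P) al e.1 e.2 = z * d by rewrite (prod_split_head _ v).
have z0 : 0 <= z by rewrite prodr_ge0.
have d01 : 0 <= d <= 1 by rewrite prodr_ge0// prodr_ile1.
have z1 : 1 <= 2 ^+ (2 ^ s) * z.
  apply: le_trans Pbig _; rewrite Psplit mulrA ler_piMr ?mulr_ge0 ?exprn_ge0//.
  by case/andP: d01.
have main := @fibre_bound P u v uv uvP vP f s (eta * al u v) (4 * d) z s0 _ _ z0
  Fle z1 fle rle.
have {}main : `|avg (fun x => hom_prod P x * f (x u) (x v))|
    <= 16 * eta * (al u v * (z * d)).
  rewrite (_ : 16 * _ * _ = 4 * z * (eta * al u v) * (4 * d)); last by ring.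
  by apply: main; rewrite mulr_ge0//; case/andP: d01.
rewrite !big_setU1//= Psplit.
have -> : avg (hom_prod ((u, v) |: P)) - al u v * avg (hom_prod P)
   = avg (fun x => hom_prod P x * f (x u) (x v))
   + avg (fun x => hom_prod P x * ((x u \in B)%:R * (a u v (x u) (x v) - al u v))).
  rewrite -avgZ -avgB -avgD; apply: eq_avg => x.
  rewrite {1}/hom_prod big_setU1//= -/(hom_prod P x) /f.
  by case: (_ \in B) => /=; ring.
have bad : `|avg (fun x =>
      hom_prod P x * ((x u \in B)%:R * (a u v (x u) (x v) - al u v)))|
    <= density R B.
  apply: le_trans (avg_norm _) _.
  rewrite -avg_indic -(avg_marginal (fun x => (x \in B)%:R)).
  apply: le_avg => x; rewrite !normrM.
  have /andP[h0 h1] := hom_prod_unit P x.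
  have n1 : `|a u v (x u) (x v) - al u v| <= 1.
    by have := a01 (x u) (x v); have := al1 u v; rewrite ler_norml; lra.
  rewrite (ger0_norm h0); case: (_ \in B); rewrite /= ?normr0 ?normr1 ?mul0r ?mulr0//.
  by rewrite mul1r mulr_ile1.
apply: le_trans (ler_normD _ _) _.
move: Bsmall; rewrite Psplit; lra.
Qed.
End Product.

(** By induction [(1 + x) ^+ j * (1 - j x) <= 1], since [(1 + x) (1 - (j + 1) x) <= 1 - j x]. *)
Lemma exprn_1Dx_le2 (R : realFieldType) (x : R) (n : nat) :
  0 <= x -> n%:R * x <= 1 / 2 -> (1 + x) ^+ n <= 2.
Proof.
move=> x0 nx; have x1 : 0 <= 1 + x by lra.
have key j : (1 + x) ^+ j * (1 - j%:R * x) <= 1.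
  elim: j => [|j IH]; first by rewrite mul0r subr0 mulr1.
  apply: le_trans IH; rewrite exprS mulrC mulrA [leRHS]mulrC.
  rewrite ler_wpM2r ?exprn_ge0// -natr1; have := ler0n R j; nra.
have := key n; have := exprn_ge0 n x1; set y := (1 + x) ^+ n; nra.
Qed.

(** * Telescoping over the edges *)

Section EdgeInduction.
Variables (R : realType) (k m : nat) (X : 'I_k -> finType).
Hypothesis X0 : forall u, (0 < #|X u|)%N.
Variables (E : {set 'I_k * 'I_k}) (a : forall i j : 'I_k, X i -> X j -> R).
Variables (al : 'I_k -> 'I_k -> R) (B : forall i j : 'I_k, {set X i}).
Variables (p t eta dl : R) (K s : nat).
Let q := (2 ^ s)%N.
Let n := (K * q).+1.
Arguments a : clear implicits.
Hypotheses (m0 : (0 < m)%N) (Em : (#|E| <= m)%N).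
Hypothesis Elt : forall i j : 'I_k, (i, j) \in E -> (i < j)%N.
Hypothesis a01 : forall i j x y, 0 <= a i j x y <= 1.
Hypotheses (p01 : 0 < p <= 1) (t0 : 0 <= t) (eta0 : 0 <= eta).
Hypothesis al_bounds : forall i j, p <= al i j <= 1.
Hypothesis rect : forall i j, (i, j) \in E -> rect_bound (a i j) ((1 + dl) * al i j) t.
Hypothesis B_small : forall i j, (i, j) \in E -> density R (B i j) <= eta * p ^+ m.
Hypothesis degB : forall i j, (i, j) \in E ->
  forall x, x \notin B i j -> (1 - dl) * al i j <= avg (a i j x).
Hypotheses (s0 : (0 < s)%N) (mq : (m <= q)%N) (p_big : 1 <= 2 ^+ q * p ^+ m).
Hypothesis t_small : n%:R * 2 ^+ n * t <= p ^+ (2 * n * m).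
Hypotheses (Keta : 16 <= K%:R * eta ^+ 2) (dl01 : 0 <= dl < 1 / 2).
Hypothesis dlK : (1 + dl) ^+ (2 * K.+1) <= 2 * (1 - 2 * dl) ^+ K.+1.
Hypothesis dlm : (1 + dl) ^+ m <= 2.
Hypothesis etam : 17 * eta * m%:R <= 1.

Let p0 : 0 < p. Proof. by case/andP: p01. Qed.
Let p1 : p <= 1. Proof. by case/andP: p01. Qed.
Let al0 i j : 0 < al i j.
Proof. by case/andP: (al_bounds i j) => + _; exact: lt_le_trans. Qed.
Let al01 i j : 0 < al i j <= 1.
Proof. by rewrite al0; case/andP: (al_bounds i j). Qed.
Let be_bounds i j : p <= (1 + dl) * al i j <= 2.
Proof. by have := al_bounds i j; have := dl01; have := p0; nra. Qed.

Lemma iavg_small (v : 'I_k) (r : seq 'I_k) (l : nat) :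
  (l <= n)%N -> (size r <= m)%N -> (forall i, i \in r -> (i, v) \in E) ->
  iavg l (fun s => \prod_(i <- r) avg (fun x => \prod_(y <- s) a i v x y) ^+ 2)
    <= \prod_(i <- r) (4 * ((1 + dl) * al i v) ^+ (2 * l)).
Proof.
move=> ln rm rE.
apply: (@upper_count_prod R _ r X (X v) (fun i => a i v)
  (fun i => (1 + dl) * al i v) t p l) => //.
  by move=> i ir; apply: rect; exact: rE.
apply: (@le_trans _ _ (n%:R * 2 ^+ n * t)).
  rewrite ler_wpM2r// ler_pM ?exprn_ge0// ?ler_nat//.
  by rewrite ler_weXn2l//; lra.
apply: le_trans t_small _; apply: ler_wiXn2l; rewrite ?(ltW p0)//.
by rewrite leq_mul// leq_mul2l ln orbT.
Qed.

Lemma size_sources (P : {set 'I_k * 'I_k}) v : P \subset E -> (size (sources P v) <= m)%N.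
Proof.
move=> PE; rewrite -cardE; apply: leq_trans Em; apply: leq_trans (subset_leq_card PE).
rewrite -(card_imset _ (_ : injective (fun i => (i, v)))); last by move=> i j [].
by apply/subset_leq_card/subsetP => _ /imsetP[i + ->]; rewrite inE.
Qed.

(** Each removed edge adds a relative error [17 * eta]. The induction is on the number of edges over
    all subsets of [E], because removing an edge also uses the count of the edges with other
    heads. *)
Lemma hom_prod_deviation (P : {set 'I_k * 'I_k}) : P \subset E ->
  `|avg (hom_prod a P) - \prod_(e in P) al e.1 e.2|
    <= 17 * eta * #|P|%:R * \prod_(e in P) al e.1 e.2.
Proof.
have pa_ge0 (Q : {set 'I_k * 'I_k}) : 0 <= \prod_(e in Q) al e.1 e.2.
  by apply: prodr_ge0 => e _; exact: ltW.
elim: {P}_.+1 {-2}P (ltnSn #|P|) => // c IH P Pc PE.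
have [->|[e0 e0P]] := set_0Vmem P.
  rewrite big_set0 cards0 mulr0 mul0r /hom_prod.
  by under eq_avg do rewrite big_set0; rewrite avg_cst ?card_point_gt0// subrr normr0.
(* With [v] maximal among the heads and tails below heads, no edge of [P] can leave [v]. *)
case: (arg_maxnP (fun e : 'I_k * 'I_k => nat_of_ord e.2) e0P) => -[u v] uvP0 vmax.
have uvP : (u, v) \in P := uvP0.
pose P' := P :\ (u, v).
have PP' : P = (u, v) |: P' by rewrite setD1K.
have uvP' : (u, v) \notin P' by rewrite setD11.
have P'P : P' \subset P by rewrite subD1set.
have P'E : P' \subset E := subset_trans P'P PE.
have uvE : (u, v) \in E by rewrite (subsetP PE).
have cP : #|P| = #|P'|.+1 by rewrite (cardsD1 (u, v)) uvP.
have uv : u != v by rewrite -val_eqE ltn_eqF// Elt.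
have vP' i j : (i, j) \in P' -> i != v.
  move=> ijP'; rewrite -val_eqE ltn_eqF//.
  by apply: leq_trans (Elt (subsetP P'E _ ijP')) (vmax (i, j) (subsetP P'P _ ijP')).
have IHle (Q : {set 'I_k * 'I_k}) : (#|Q| <= #|P'|)%N -> Q \subset E ->
    `|avg (hom_prod a Q) - \prod_(e in Q) al e.1 e.2|
      <= 17 * eta * #|Q|%:R * \prod_(e in Q) al e.1 e.2.
  by move=> QP' QE; apply: IH => //; rewrite -ltnS; apply: leq_trans Pc; rewrite cP !ltnS.
have p_prod (Q : {set 'I_k * 'I_k}) : Q \subset E -> p ^+ m <= \prod_(e in Q) al e.1 e.2.
  move=> QE; apply: (@le_trans _ _ (p ^+ #|Q|)).
    by apply: ler_wiXn2l; rewrite ?(ltW p0)// (leq_trans (subset_leq_card QE)).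
  rewrite -prodr_const; apply: ler_prod => e _; rewrite (ltW p0).
  by case/andP: (al_bounds e.1 e.2).
have qn : (q <= n)%N.
  rewrite /n ltnW// ltnS leq_pmull//; case: (K) Keta => //; rewrite mul0r; lra.
have step : `|avg (hom_prod a P) - al u v * avg (hom_prod a P')|
    <= 17 * eta * \prod_(e in P) al e.1 e.2.
  rewrite {1 2}PP'; apply: (@remove_edge R k X X0 a a01 P' u v (B u v) al s eta) => //.
  - apply: le_trans (B_small uvE) _; rewrite ler_wpM2l//.
    by have := p_prod _ PE; rewrite {1}PP' big_setU1.
  - by apply: le_trans p_big _; rewrite ler_wpM2l ?exprn_ge0// p_prod.
  (* The relative error of the count of [F] is at most [17 * eta * m <= 1], whence the factor 2. *)
  - set F := [set e in P' | _].
    have FP' : F \subset P' by apply/subsetP => e; rewrite inE => /andP[].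
    have FE := subset_trans FP' P'E.
    have := IHle F (subset_leq_card FP') FE; set z := \prod_(e in F) _.
    have : 17 * eta * #|F|%:R * z <= 1 * z.
      rewrite ler_wpM2r// ?pa_ge0//; apply: le_trans etam.
      rewrite ler_wpM2l ?mulr_ge0// ler_nat.
      by rewrite (leq_trans (subset_leq_card FE)).
    by rewrite ler_norml; lra.
  - have nodd : ~~ odd q by rewrite /q oddX negb_or -lt0n s0.
    have q0 : (0 < q)%N by rewrite expn_gt0.
    apply: (grid_norm_le (X0 u) (X0 v) (al0 u v) dl01 Keta q0 nodd dlK) => [x y|x xB|].
    + by case/andP: (a01 x y).
    + exact: degB.
    (* The single tail [u] with tuples of the full length [n] gives the moment bound for [a u v]. *)
    have := @iavg_small v [:: u] n (leqnn _) m0.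
    rewrite big_seq1; under eq_iavg do rewrite big_seq1.
    by apply=> i; rewrite inE => /eqP ->.
  - set r := sources P' v; have rm : (size r <= m)%N by exact: size_sources.
    apply: le_trans (iavg_small qn rm _) _.
      by move=> i; rewrite mem_enum inE => /(subsetP P'E).
    rewrite big_split/= prodrXl big_split/= !big_const_seq !count_predT !iter_mulr_1.
    set z := \prod_(i <- r) _.
    have z0 : 0 <= z by apply: prodr_ge0 => i _; exact: ltW.
    (* The factors 4 amount to at most [4 ^+ q], as there are at most [m <= q] tails; the factors
       [1 + dl] multiply to at most 2. *)
    apply: (@le_trans _ _ (2 ^+ (2 * q) * (2 * z) ^+ (2 * q))).
      apply: ler_pM; rewrite ?exprn_ge0//.
      + by rewrite mulr_ge0// exprn_ge0//; move: dl01; lra.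
      + rewrite exprM (_ : 2 ^+ 2 = 4); last by ring.
        by rewrite ler_weXn2l//; [lra | exact: leq_trans mq].
      + rewrite lerXn2r ?nnegrE ?mulr_ge0 ?exprn_ge0//; first by move: dl01; lra.
        rewrite ler_wpM2r//; apply: le_trans dlm.
        by rewrite ler_weXn2l//; move: dl01; lra.
    by rewrite -exprMn mulrA (_ : 2 * 2 = 4)//; ring.
have prodP : \prod_(e in P) al e.1 e.2 = al u v * \prod_(e in P') al e.1 e.2.
  by rewrite {1}PP' big_setU1.
have IHP' := ler_wpM2l (ltW (al0 u v)) (IHle P' (leqnn _) P'E).
rewrite (_ : avg (hom_prod a P) - _ = (avg (hom_prod a P) - al u v * avg (hom_prod a P'))
  + al u v * (avg (hom_prod a P') - \prod_(e in P') al e.1 e.2)); last first.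
  by rewrite prodP; ring.
apply: le_trans (ler_normD _ _) _; rewrite normrM (gtr0_norm (al0 u v)).
apply: le_trans (lerD step IHP') _.
rewrite prodP cP -[X in _ <= _ * X * _]natr1 le_eqVlt; apply/orP; left; apply/eqP; ring.
Qed.
End EdgeInduction.

(** * Choice of the parameters and conclusion *)

Lemma between_pow2 (R : realType) (x : R) : 1 <= x ->
  exists2 s, (0 < s)%N & x <= (2 ^ s)%:R <= 2 * x.
Proof.
move=> x1; have x0 : 0 <= x by lra.
have /andP[jx xj] := truncn_itv x0; set j := Num.truncn x in jx xj.
have j0 : (0 < j)%N by rewrite lt0n; apply: contraTneq xj => ->; rewrite -leNgt.
have /andP[lo hi] := trunc_log_bounds (isT : 1 < 2)%N j0.
exists (trunc_log 2 j).+1 => //; apply/andP; split.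
  by apply: le_trans (ltW xj) _; rewrite ler_nat.
rewrite expnS natrM ler_wpM2l//; apply: le_trans jx; by rewrite ler_nat.
Qed.

Lemma expectT (R : realType) (T : finType) (f : T -> R) :
  expect [set: T] f = avg f.
Proof.
by rewrite /expect /avg cardsT; congr (_ / _); apply: eq_bigl => x; rewrite inE.
Qed.

Lemma pow2_log2 (R : realType) (x : R) : 0 < x -> 2 `^ log2 x = x.
Proof.
move=> x0; rewrite /powR pnatr_eq0/= /log2 mulfVK ?lnK ?posrE//.
by rewrite gt_eqF// ln_gt0//; lra.
Qed.

Lemma natr_le_pow2 (R : numDomainType) (n : nat) : n%:R <= 2 ^+ n :> R.
Proof. by rewrite -natrX ler_nat ltnW// ltn_expl. Qed.

Theorem theorem2p1 (R : realType) (m : nat) (hm : (0 < m)%N)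
    (eps : R) (heps0 : 0 < eps) (heps1 : eps < 1) :
  exists delta C : R,
    [/\ 0 < delta, 0 < C &
      forall (k : nat) (E : {set 'I_k * 'I_k}),
        oriented E -> #|E| = m ->
        (forall u v : 'I_k, (u, v) \in E -> (u < v)%N) ->
      forall alpha : R, 0 < alpha ->
      forall X : 'I_k -> finType, (forall u : 'I_k, (0 < #|X u|)%N) ->
      forall A : (forall u v : 'I_k, {set X u * X v}),
        (forall u v : 'I_k, (u, v) \in E -> alpha <= density R (A u v)) ->
        eps * \prod_(e in E) density R (A e.1 e.2)
          <= `|hom_density R E A - \prod_(e in E) density R (A e.1 e.2)| ->
      exists u v : 'I_k, (u, v) \in E /\
        ((exists (S : {set X u}) (T : {set X v}),
            [/\ 2 `^ (- (C * log2 (2 / alpha) ^+ 2)) <= density R S,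
                2 `^ (- (C * log2 (2 / alpha) ^+ 2)) <= density R T &
                (1 + delta) * density R (A u v)
                  <= expect (setX S T) (indic R (A u v))])
         \/
         (exists S : {set X u},
            2 `^ (- (C * log2 (2 / alpha))) <= density R S /\
            forall z : X u, z \in S ->
              expect [set: X v] (fun x => indic R (A u v) (z, x))
                <= (1 - delta) * density R (A u v)))].
Proof.
(* The total relative error is [17 * eta * m = 17 * eps / 64 < eps]. *)
pose eta := eps / (64 * m%:R).
have m1 : 1 <= m%:R :> R by rewrite ler1n.
have eta0 : 0 < eta by rewrite divr_gt0// mulr_gt0//; lra.
have etam : eta * m%:R = eps / 64 by rewrite /eta; field; rewrite gt_eqF//; lra.
have [K Keta] : exists K : nat, 16 <= K%:R * eta ^+ 2.
  exists (Num.bound (16 / eta ^+ 2)); rewrite -ler_pdivrMr ?exprn_gt0// ltW//.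
  by rewrite archi_boundP// divr_ge0// sqr_ge0.
have [c etac] : exists c : nat, 1 <= 2 ^+ c * eta.
  exists (Num.bound (1 / eta)); rewrite -ler_pdivrMr//.
  apply: le_trans (natr_le_pow2 _ _); rewrite ltW// archi_boundP//.
  by rewrite divr_ge0// ltW.
(* [dl] is small against both [K + 1] and [m], so that powers of [1 + 8 * dl] and of [1 + dl] with
   these exponents stay below 2. *)
pose n0 := (K.+1 + m)%N.
have n01 : 1 <= n0%:R :> R by rewrite ler1n.
pose dl : R := 1 / (16 * n0%:R).
have dl0 : 0 < dl by rewrite divr_gt0// mulr_gt0//; lra.
have n0dl : n0%:R * dl = 1 / 16 by rewrite /dl; field; rewrite gt_eqF//; lra.
have small j : (j <= n0)%N -> j%:R * dl <= 1 / 16.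
  by move=> jn; rewrite -n0dl ler_wpM2r ?ler_nat// ltW.
have dl16 : dl <= 1 / 16 by have := small 1%N isT; lra.
(* With [n <= 2 * n0 * m * L], the product gives [C * L^2 >= 2 * n + 2 * n * m * L], needed for [t];
   the summand [c + m] gives [C * L >= c + m * L], needed for the low-degree sets. *)
pose C := ((2 * m + 2) * (2 * n0 * m) + c + m)%N.
exists dl, C%:R; split=> //; first by rewrite ltr0n addn_gt0 hm orbT.
move=> k E _ Em Elt alpha alpha0 X X0 A A_dense dev.
pose L := log2 (2 / alpha).
have [e0 e0E] : exists e0, e0 \in E by apply/card_gt0P; rewrite Em.
have alpha1 : alpha <= 1.
  by apply: le_trans (density_le1 R (A e0.1 e0.2)); apply: A_dense;
    rewrite -surjective_pairing.
have L2 : 2 `^ L = 2 / alpha by rewrite pow2_log2// divr_gt0.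
have le_pow2 (x y : R) : x <= y -> 2 `^ x <= 2 `^ y by apply: ler_powR; lra.
have pow2N (x : R) : 2 `^ (- x) = (2 `^ x)^-1 by rewrite powRN.
have L1 : 1 <= L.
  rewrite ler_pdivlMr ?mul1r ?ln_gt0//; last by lra.
  by rewrite ler_ln ?posrE ?divr_gt0// ler_pdivlMr//; lra.
have L0 : 0 <= L by lra.
(* This is [alpha / 2], a lower bound for all densities; written as a power of 2, it reduces the
   later inequalities to exponents. *)
pose p := 2 `^ (- L).
have pE : p = alpha / 2 by rewrite /p pow2N L2 invf_div.
have pX j : p ^+ j = 2 `^ (- (L * j%:R)).
  by rewrite -powR_mulrn ?powR_ge0// -powRrM mulNr.
have twoX j : 2 ^+ j = 2 `^ (j%:R) :> R by rewrite powR_mulrn.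
have p01 : 0 < p <= 1 by rewrite pE; lra.
pose t := 2 `^ (- (C%:R * L ^+ 2)).
have t0 : 0 < t by rewrite powR_gt0.
have CE : C%:R = (2 * m%:R + 2) * (2 * n0%:R * m%:R) + c%:R + m%:R :> R.
  by rewrite /C !(natrD, natrM).
have mL1 : 1 <= m%:R * L by nra.
(* [q >= m * L] yields [2 ^+ q * p ^+ m >= 1], while [q <= 2 * m * L] keeps [n] of order [L]. *)
have [s s0 /andP[qL qU]] := between_pow2 mL1.
set q := (2 ^ s)%N in qL qU.
have q0 : (0 < q)%N by rewrite expn_gt0.
have mq : (m <= q)%N by rewrite -(ler_nat R); apply: le_trans qL; nra.
pose n := (K * q).+1.
have nU : n%:R <= 2 * n0%:R * m%:R * L.
  apply: (@le_trans _ _ (n0%:R * q%:R)); last by nra.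
  rewrite -natrM ler_nat; apply: (@leq_trans (K.+1 * q)).
    by rewrite /n mulSn -add1n leq_add2r.
  by rewrite leq_mul2r leq_addr orbT.
apply: contrapT => no_case.
have no_rect u v : (u, v) \in E -> forall (S : {set X u}) (T : {set X v}),
    t <= density R S -> t <= density R T ->
    expect (setX S T) (indic R (A u v)) < (1 + dl) * density R (A u v).
  move=> uvE S T tS tT; rewrite ltNge; apply/negP => inc.
  by apply: no_case; exists u, v; split => //; left; exists S, T.
pose a i j x y := indic R (A i j) (x, y).
(* The value 1 off [E] makes the bounds on [al] hold for all pairs. *)
pose al i j := if (i, j) \in E then density R (A i j) else 1.
pose B i j := [set x | avg (a i j x) <= (1 - dl) * density R (A i j)].
have prodE : \prod_(e in E) density R (A e.1 e.2) = \prod_(e in E) al e.1 e.2.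
  by apply: eq_bigr => e eE; rewrite /al -surjective_pairing eE.
have homE : hom_density R E A = avg (hom_prod a E) by exact: expectT.
rewrite prodE homE in dev.
have al_bounds i j : p <= al i j <= 1.
  rewrite /al; case: ifP => ijE; last by case/andP: p01 => _ ->; rewrite lexx.
  by rewrite density_le1 andbT; have := A_dense i j ijE; rewrite pE; lra.
suff : `|avg (hom_prod a E) - \prod_(e in E) al e.1 e.2|
    <= 17 * eta * m%:R * \prod_(e in E) al e.1 e.2.
  apply/negP; rewrite -ltNge; apply: lt_le_trans dev.
  rewrite -[17 * _ * _]mulrA etam ltr_pM2r; first by lra.
  apply: prodr_gt0 => e _; apply: lt_le_trans (_ : 0 < p) _; first by case/andP: p01.
  by case/andP: (al_bounds e.1 e.2).
rewrite -Em; apply: (@hom_prod_deviation R k m X X0 E a al B p t eta dl K s hm _ Elt _ p01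
  (ltW t0) (ltW eta0) al_bounds _ _ _ s0 mq _ _ Keta _ _ _ _ E (subxx _)).
- by rewrite Em.
- by move=> i j x y; rewrite /a /indic ler0n lern1 leq_b1.
- move=> i j ijE; rewrite /al ijE; apply: rect_bound_of_no_increment => //.
    by rewrite mulr_ge0 ?divr_ge0//; lra.
  exact: no_rect.
(* A low-degree set of larger density would itself be the [S] of case 2. *)
- move=> i j ijE; have [Bs|Bl] := lerP (density R (B i j)) (2 `^ (- (C%:R * L))).
    apply: le_trans Bs _.
    apply: (@le_trans _ _ ((2 ^+ c)^-1 * p ^+ m)); last first.
      rewrite ler_wpM2r ?exprn_ge0//; first by case/andP: p01 => /ltW.
      by rewrite -[leLHS]mul1r ler_pdivrMr ?exprn_gt0// mulrC.
    rewrite twoX -pow2N pX -powRD ?pnatr_eq0 ?implybT//; apply: le_pow2.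
    have h1 : 0 <= c%:R :> R by [].
    have h2 : 0 <= (2 * m%:R + 2) * (2 * n0%:R * m%:R) * L :> R.
      by apply: mulr_ge0 L0; rewrite -!natrM -natrD -natrM.
    rewrite CE; nra.
  case: no_case; exists i, j; split => //; right; exists (B i j); split; first exact: ltW.
  by move=> z; rewrite inE expectT.
- move=> i j ijE x; rewrite inE -ltNge /al ijE; exact: ltW.
- rewrite twoX pX -powRD ?pnatr_eq0 ?implybT// -[leLHS](powRr0 2); apply: le_pow2; lra.
- apply: (@le_trans _ _ (2 ^+ n * 2 ^+ n * t)).
    by rewrite ler_wpM2r ?(ltW t0)// ler_wpM2r ?exprn_ge0// natr_le_pow2.
  rewrite -exprD twoX pX -powRD ?pnatr_eq0 ?implybT//; apply: le_pow2.
  have nL : n%:R <= n%:R * L by rewrite ler_peMr.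
  have nLL : n%:R * L <= 2 * n0%:R * m%:R * L ^+ 2 by rewrite expr2 mulrA ler_wpM2r.
  have h : 0 <= (c%:R + m%:R) * L ^+ 2 by rewrite mulr_ge0 ?sqr_ge0// addr_ge0.
  have mm : 0 <= 2 * m%:R + 2 :> R by lra.
  move: (ler_wpM2l mm nLL) nL h; rewrite CE natrD !natrM.
  move: (n%:R) => nR; lra.
- by rewrite ltW//=; lra.
(* For [dl <= 1 / 16], [(1 + dl)^2 <= (1 + 8 * dl) * (1 - 2 * dl)]. *)
- rewrite exprM; apply: (@le_trans _ _ (((1 + 8 * dl) * (1 - 2 * dl)) ^+ K.+1)).
    by rewrite lerXn2r ?nnegrE; nra.
  rewrite exprMn ler_wpM2r ?exprn_ge0//; first by lra.
  apply: exprn_1Dx_le2; first by lra.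
  by have := small K.+1 (leq_addr _ _); lra.
- apply: exprn_1Dx_le2; first by exact: ltW.
  by have := small m (leq_addl _ _); lra.
- by rewrite -mulrA etam; lra.
Qed.
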